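(* Let $A$ be a commutative ring with identity. The following conditions are equivalent: (i) $A$ is a semi-hereditary ring; (ii) every torsion-free $A$-module is flat.
   Context: All rings are commutative with identity. A ring $A$ is called semi-hereditary if every finitely generated ideal of $A$ is projective as an $A$-module. An $A$-module $M$ is called torsion-free if for every non-zero-divisor $a \in A$ the multiplication map $M \to M$, $x \mapsto ax$, is injective. *)

(* Defs.v *)
From HB Require Import structures.
From mathcomp Require Import all_boot all_algebra.
From mathcomp Require Import boolp.

Set Implicit Arguments.
Unset Strict Implicit.
Unset Printing Implicit Defensive.

Import GRing.Theory.
Local Open Scope ring_scope.
Local Open Scope quotient_scope.

(* comPzRingType: the zero ring is a ring, as in the usual convention for
   commutative rings with identity. *)

Definition torsion_free (A : comPzRingType) (M : lmodType A) : Prop :=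
  forall a : A, GRing.lreg a -> injective (fun x : M => a *: x).

Definition projective (A : comPzRingType) (P : lmodType A) : Prop :=
  forall (M N : lmodType A) (g : {linear M -> N}) (f : {linear P -> N}),
    (forall y : N, exists x : M, g x = y) ->
    exists h : {linear P -> M}, forall x : P, g (h x) = f x.

(* An ideal of A is a submodule of the regular module A^o, and
   [ideal_module I] is I with its A-module structure. *)
Record ideal_module (A : comPzRingType) (I : submodClosed A^o) : Type :=
  IdealModule { ideal_val : A^o; _ : ideal_val \in I }.

HB.instance Definition _ (A : comPzRingType) (I : submodClosed A^o) :=
  [isSub for @ideal_val A I].
HB.instance Definition _ (A : comPzRingType) (I : submodClosed A^o) :=
  [Choice of ideal_module I by <:].
HB.instance Definition _ (A : comPzRingType) (I : submodClosed A^o) :=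
  [SubChoice_isSubLmodule of ideal_module I by <:].

Definition fg_ideal (A : comPzRingType) (I : submodClosed A^o) : Prop :=
  exists (n : nat) (g : 'I_n -> A), forall x : A,
    x \in I <-> exists c : 'I_n -> A, x = \sum_(i < n) c i * g i.

Definition semi_hereditary (A : comPzRingType) : Prop :=
  forall I : submodClosed A^o, fg_ideal I -> projective (ideal_module I).

Section Tensor.
Variables (A : comPzRingType) (N M : lmodType A).

(* A sequence of pairs stands for the formal sum of the pure tensors of its
   items, and the tensor product is the quotient of these formal sums by the
   congruence generated by the bilinearity relations.  No formal negatives are
   needed, since (- x) (x) y is the opposite of x (x) y. *)
Inductive tensor_rel : seq (N * M) -> seq (N * M) -> Prop :=
| tensor_refl s : tensor_rel s s
| tensor_sym s t : tensor_rel s t -> tensor_rel t s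
| tensor_trans t s u : tensor_rel s t -> tensor_rel t u -> tensor_rel s u
| tensor_perm s t : perm_eq s t -> tensor_rel s t
| tensor_cat s s' t t' :
    tensor_rel s t -> tensor_rel s' t' -> tensor_rel (s ++ s') (t ++ t')
| tensor_0 y : tensor_rel [:: (0, y)] [::]
| tensor_Dl x x' y : tensor_rel [:: (x + x', y)] [:: (x, y); (x', y)]
| tensor_Dr x y y' : tensor_rel [:: (x, y + y')] [:: (x, y); (x, y')]
| tensor_Z a x y : tensor_rel [:: (a *: x, y)] [:: (x, a *: y)].

Definition tensor_eqb : rel (seq (N * M)) := fun s t => `[< tensor_rel s t >].

Lemma tensor_eqb_refl : reflexive tensor_eqb.
Proof. by move=> s; apply/asboolP; exact: tensor_refl. Qed.

Lemma tensor_eqb_sym : symmetric tensor_eqb.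
Proof. by move=> s t; apply/asboolP/asboolP; exact: tensor_sym. Qed.

Lemma tensor_eqb_trans : transitive tensor_eqb.
Proof.
by move=> t s u /asboolP st /asboolP tu; apply/asboolP; exact: tensor_trans tu.
Qed.

Canonical tensor_equiv :=
  EquivRel tensor_eqb tensor_eqb_refl tensor_eqb_sym tensor_eqb_trans.

Definition tensor : Type := {eq_quot tensor_equiv}.
HB.instance Definition _ := Choice.on tensor.

Definition tclass (s : seq (N * M)) : tensor := \pi_({eq_quot tensor_equiv}) s.
Definition trepr (t : tensor) : seq (N * M) :=
  repr (t : {eq_quot tensor_equiv}).

Lemma treprK : cancel trepr tclass.
Proof. by move=> t; exact: reprK. Qed.

Lemma tclassP s t : tclass s = tclass t <-> tensor_rel s t.
Proof.
split=> [/eqmodP/asboolP //|st].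
by apply/eqmodP/asboolP.
Qed.

Lemma trepr_class s : tensor_rel (trepr (tclass s)) s.
Proof. by apply/tclassP; rewrite treprK. Qed.

Definition tscale_seq (a : A) (s : seq (N * M)) : seq (N * M) :=
  [seq (a *: p.1, p.2) | p <- s].

Lemma tscale_seq_rel a s t :
  tensor_rel s t -> tensor_rel (tscale_seq a s) (tscale_seq a t).
Proof.
elim=> {s t} [s|s t _ IH|t s u _ IH1 _ IH2|s t st|s s' t t' _ IH1 _ IH2|y
             |x x' y|x y y'|b x y] /=.
- exact: tensor_refl.
- exact: tensor_sym.
- exact: tensor_trans IH2.
- by apply: tensor_perm; exact: perm_map.
- by rewrite /tscale_seq !map_cat; exact: tensor_cat.
- by rewrite /tscale_seq /= scaler0; exact: tensor_0.
- by rewrite /tscale_seq /= scalerDr; exact: tensor_Dl.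
- exact: tensor_Dr.
- by rewrite /tscale_seq /= scalerA mulrC -scalerA; exact: tensor_Z.
Qed.

Definition tensor_zero : tensor := tclass [::].
Definition tensor_add (t u : tensor) : tensor := tclass (trepr t ++ trepr u).
Definition tensor_scale (a : A) (t : tensor) : tensor :=
  tclass (tscale_seq a (trepr t)).
Definition tensor_opp (t : tensor) : tensor := tensor_scale (- 1) t.

Lemma tclass_cat s t : tensor_add (tclass s) (tclass t) = tclass (s ++ t).
Proof. by apply/tclassP; apply: tensor_cat; exact: trepr_class. Qed.

Lemma tclass_scale a s : tensor_scale a (tclass s) = tclass (tscale_seq a s).
Proof. by apply/tclassP; apply: tscale_seq_rel; exact: trepr_class. Qed.

Lemma tensor_addA : associative tensor_add.
Proof.
move=> t u v; rewrite -[t]treprK -[u]treprK -[v]treprK.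
by rewrite !tclass_cat catA.
Qed.

Lemma tensor_addC : commutative tensor_add.
Proof.
move=> t u; apply/tclassP; apply: tensor_perm.
by rewrite perm_catC.
Qed.

Lemma tensor_add0 : left_id tensor_zero tensor_add.
Proof. by move=> t; rewrite -[t]treprK tclass_cat. Qed.

Lemma tensor_scaleDl_subproof (t : tensor) (a b : A) :
  tensor_scale (a + b) t = tensor_add (tensor_scale a t) (tensor_scale b t).
Proof.
rewrite -[t]treprK !tclass_scale tclass_cat; apply/tclassP.
elim: (trepr t) => [|[x y] s IH] /=; first exact: tensor_refl.
apply: (@tensor_trans ([:: (a *: x, y); (b *: x, y)] ++
                        (tscale_seq a s ++ tscale_seq b s))).
  rewrite -cat1s; apply: tensor_cat IH.
  by rewrite scalerDl; exact: tensor_Dl.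
apply: tensor_perm; rewrite /= perm_cons -cat1s catA [X in perm_eq _ X]/=.
by rewrite -[X in perm_eq _ (_ ++ X)]cat1s catA perm_cat2r perm_catC.
Qed.

Lemma tensor_scale0_subproof (t : tensor) : tensor_scale 0 t = tensor_zero.
Proof.
rewrite -[t]treprK tclass_scale; apply/tclassP.
elim: (trepr t) => [|[x y] s IH] /=; first exact: tensor_refl.
rewrite -cat1s -[[::]]cat0s; apply: tensor_cat IH.
by rewrite scale0r; exact: tensor_0.
Qed.

Lemma tensor_scale1_subproof : left_id 1 tensor_scale.
Proof.
move=> t; rewrite -[t]treprK tclass_scale; congr tclass.
by rewrite /tscale_seq -[RHS]map_id; apply: eq_map => -[x y] /=; rewrite scale1r.
Qed.

Lemma tensor_addN : left_inverse tensor_zero tensor_opp tensor_add.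
Proof.
move=> t; rewrite -{2}[t]tensor_scale1_subproof -tensor_scaleDl_subproof.
by rewrite addNr tensor_scale0_subproof.
Qed.

HB.instance Definition _ :=
  GRing.isZmodule.Build tensor tensor_addA tensor_addC tensor_add0 tensor_addN.

Lemma tensor_scaleA a b (t : tensor) :
  tensor_scale a (tensor_scale b t) = tensor_scale (a * b) t.
Proof.
rewrite -[t]treprK !tclass_scale /tscale_seq -map_comp.
by congr tclass; apply: eq_map => p /=; rewrite scalerA.
Qed.

Lemma tensor_scaleDr : right_distributive tensor_scale tensor_add.
Proof.
move=> a t u; rewrite -[t]treprK -[u]treprK tclass_cat !tclass_scale.
by rewrite tclass_cat /tscale_seq map_cat.
Qed.

Lemma tensor_scaleDl (t : tensor) : {morph tensor_scale^~ t : a b / a + b}.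
Proof. exact: tensor_scaleDl_subproof. Qed.

HB.instance Definition _ := GRing.Zmodule_isLmodule.Build A tensor
  tensor_scaleA tensor_scale1_subproof tensor_scaleDr tensor_scaleDl.

Definition tens (x : N) (y : M) : tensor := tclass [:: (x, y)].

Lemma tensDl x x' y : tens (x + x') y = tens x y + tens x' y.
Proof. by rewrite [RHS]tclass_cat; apply/tclassP; exact: tensor_Dl. Qed.

Lemma tensDr x y y' : tens x (y + y') = tens x y + tens x y'.
Proof. by rewrite [RHS]tclass_cat; apply/tclassP; exact: tensor_Dr. Qed.

Lemma tensZl a x y : tens (a *: x) y = a *: tens x y.
Proof. by rewrite [RHS]tclass_scale. Qed.

Lemma tensZr a x y : tens x (a *: y) = a *: tens x y.
Proof. by rewrite -tensZl; apply/esym/tclassP; exact: tensor_Z. Qed.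

Lemma tclassE s : tclass s = \sum_(p <- s) tens p.1 p.2.
Proof.
elim: s => [|[x y] s IH]; first by rewrite big_nil.
by rewrite big_cons -IH [RHS]tclass_cat.
Qed.

Lemma tensorE (t : tensor) : t = \sum_(p <- trepr t) tens p.1 p.2.
Proof. by rewrite -tclassE treprK. Qed.

Definition bilinear_map (P : lmodType A) (b : N -> M -> P) : Prop :=
  (forall y, linear (b^~ y)) /\ (forall x, linear (b x)).

Definition tensor_lift (P : lmodType A) (b : N -> M -> P) (t : tensor) : P :=
  \sum_(p <- trepr t) b p.1 p.2.

Lemma tensor_rel_sum (P : lmodType A) (b : N -> M -> P) s t :
  bilinear_map b -> tensor_rel s t ->
  \sum_(p <- s) b p.1 p.2 = \sum_(p <- t) b p.1 p.2.
Proof.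
move=> [bl br].
have bDl x x' y : b (x + x') y = b x y + b x' y.
  by have := bl y 1 x x'; rewrite !scale1r.
have bDr x y y' : b x (y + y') = b x y + b x y'.
  by have := br x 1 y y'; rewrite !scale1r.
have b0l y : b 0 y = 0.
  by apply: (addrI (b 0 y)); rewrite -bDl !addr0.
have b0r x : b x 0 = 0.
  by apply: (addrI (b x 0)); rewrite -bDr !addr0.
have bZl a x y : b (a *: x) y = a *: b x y.
  by have := bl y a x 0; rewrite !addr0 b0l addr0.
have bZr a x y : b x (a *: y) = a *: b x y.
  by have := br x a y 0; rewrite !addr0 b0r addr0.
elim=> {s t} [//|s t _ //|t s u _ -> _ -> //|s t st|s s' t t' _ IH1 _ IH2|y
             |x x' y|x y y'|a x y].
- exact: perm_big.
- by rewrite !big_cat /= IH1 IH2.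
- by rewrite big_seq1 big_nil b0l.
- by rewrite big_seq1 big_cons big_seq1 bDl.
- by rewrite big_seq1 big_cons big_seq1 bDr.
- by rewrite !big_seq1 bZl bZr.
Qed.

Lemma tensor_liftE (P : lmodType A) (b : N -> M -> P) x y :
  bilinear_map b -> tensor_lift b (tens x y) = b x y.
Proof.
move=> bb; rewrite /tensor_lift (tensor_rel_sum bb (trepr_class _)).
by rewrite big_seq1.
Qed.

Lemma tensor_lift_linear (P : lmodType A) (b : N -> M -> P) :
  bilinear_map b -> linear (tensor_lift b).
Proof.
move=> bb a t u.
have -> : a *: t + u = tclass (tscale_seq a (trepr t) ++ trepr u).
  by rewrite -[in LHS](treprK t) -[in LHS](treprK u)
             [a *: _]tclass_scale [LHS]tclass_cat.
rewrite /tensor_lift (tensor_rel_sum bb (trepr_class _)) big_cat big_map /=.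
congr (_ + _); rewrite scaler_sumr; apply: eq_bigr => p _.
have b0 : b 0 p.2 = 0.
  apply: (addrI (b 0 p.2)).
  by have := bb.1 p.2 1 0 0; rewrite !scale1r addr0 => /= e; rewrite addr0 -e.
by have := bb.1 p.2 a p.1 0; rewrite !addr0 b0 addr0.
Qed.

Lemma tensor_lift_unique (P : lmodType A) (b : N -> M -> P)
    (h : {linear tensor -> P}) :
  (forall x y, h (tens x y) = b x y) -> h =1 tensor_lift b.
Proof.
move=> hb t; rewrite {1}(tensorE t) linear_sum /tensor_lift.
by apply: eq_bigr => p _; exact: hb.
Qed.

End Tensor.

(* The map f (x) id_M. *)
Definition tensor_map (A : comPzRingType) (M N N' : lmodType A)
    (f : {linear N -> N'}) : tensor N M -> tensor N' M :=
  tensor_lift (fun x y => tens (f x) y).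
Arguments tensor_map {A} M {N N'} f.

Lemma tensor_map_bilinear (A : comPzRingType) (M N N' : lmodType A)
    (f : {linear N -> N'}) :
  @bilinear_map A N M (tensor N' M) (fun (x : N) (y : M) => tens (f x) y).
Proof.
split=> [y a x x'|x a y y']; first by rewrite /= linearP tensDl tensZl.
by rewrite tensDr tensZr.
Qed.

HB.instance Definition _ (A : comPzRingType) (M N N' : lmodType A)
    (f : {linear N -> N'}) :=
  GRing.isLinear.Build A (tensor N M) (tensor N' M) *:%R (@tensor_map A M N N' f)
    (tensor_lift_linear (tensor_map_bilinear M f)).

Lemma tensor_mapE (A : comPzRingType) (M N N' : lmodType A)
    (f : {linear N -> N'}) (x : N) (y : M) :
  tensor_map M f (tens x y) = tens (f x) y.
Proof. exact: tensor_liftE (tensor_map_bilinear M f). Qed.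

Definition flat (A : comPzRingType) (M : lmodType A) : Prop :=
  forall (N N' : lmodType A) (f : {linear N -> N'}),
    injective f -> injective (tensor_map M f).

(* Main.v *)
(* Both conditions are equivalent to: every row a over A has a dual basis
   matrix C, that is, a C = a, and C r = 0 whenever a r = 0.  This is a
   reformulation of the projectivity of the ideal generated by a.

   From flatness: in the torsion-free module M = A^n / {v | s v in A a for a
   regular s}, the relation sum a_i e_i = 0 is trivial by flatness, so 1 = C + D
   with a D = 0 and the rows of C in the submodule divided out.  A common
   regular s gives s C = t a for a column t, so C is a dual basis.

   To flatness: if M is torsion-free and a z = 0 with z in M^n, then C z is
   killed by the a_k.  By the case n = 1 there are idempotents e_k killing a_k
   with a_k + e_k regular; they fix C z, and their product kills C, so C z = 0
   and z = (1 - C) z with a (1 - C) = 0.  Hence finitely many relations in M are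
   trivialized by one matrix, an equality of tensors in N (x) M already
   holds in some N (x) A^p = N^p, and equality there is reflected by injective
   maps. *)
From HB Require Import structures.
Require Import Defs.
From mathcomp Require Import all_boot all_algebra.
From mathcomp Require Import boolp.

Set Implicit Arguments.
Unset Strict Implicit.
Unset Printing Implicit Defensive.

Import GRing.Theory.
Local Open Scope ring_scope.
Local Open Scope quotient_scope.

(** * Submodules cut out by predicates, and quotient modules *)

Section Submodules.
Variables (A : comPzRingType) (V : lmodType A).

Lemma asbool_submod_closed (P : V -> Prop) :
  P 0 -> (forall a x y, P x -> P y -> P (a *: x + y)) ->
  subsemimod_closed (fun x => `[< P x >]).
Proof.
move=> P0 PL.
have PZ a x : P x -> P (a *: x) by move=> Px; rewrite -[_ *: _]addr0; apply: PL.
split; last by move=> a x /asboolP Px; apply/asboolP; apply: PZ.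
split; first by apply/asboolP.
move=> x y /asboolP Px /asboolP Py; apply/asboolP.
by rewrite -[x]scale1r; apply: PL.
Qed.

Definition submod_of (P : V -> Prop) (P0 : P 0)
    (PL : forall a x y, P x -> P y -> P (a *: x + y)) : submodClosed V :=
  HB.pack (fun x : V => `[< P x >])
    (GRing.isSubmodClosed.Build A V (fun x : V => `[< P x >])
       (asbool_submod_closed P0 PL)).

Lemma submod_ofP (P : V -> Prop) (P0 : P 0) PL x :
  reflect (P x) (x \in @submod_of P P0 PL).
Proof. exact: asboolP. Qed.

Variable I : submodClosed V.

Definition submod_zmod : zmodClosed V :=
  HB.pack (I : {pred V}) (GRing.isZmodClosed.Build V (I : {pred V})
    (GRing.subsemimod_closedB (GRing.subsemimodClosedP I))).

Definition quotmod : Type := Quotient.quot submod_zmod.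
HB.instance Definition _ := GRing.Zmodule.on quotmod.

Definition qclass (x : V) : quotmod := \pi_(Quotient.quot submod_zmod) x.
Definition qrepr (x : quotmod) : V := repr (x : Quotient.quot submod_zmod).

Lemma qreprK : cancel qrepr qclass.
Proof. by move=> x; exact: reprK. Qed.

Lemma qclassE x y : (qclass x == qclass y) = (x - y \in I).
Proof. exact: esym (Quotient.idealrBE submod_zmod x y). Qed.

Lemma qrepr_class x : qrepr (qclass x) - x \in I.
Proof. by rewrite -qclassE qreprK. Qed.

Lemma qclassD x y : qclass (x + y) = qclass x + qclass y.
Proof. exact: Quotient.pi_add. Qed.

Definition qscale (a : A) (x : quotmod) : quotmod := qclass (a *: qrepr x).

Lemma qclassZ a x : qclass (a *: x) = qscale a (qclass x).
Proof.
apply/eqP; rewrite eq_sym qclassE -scalerBr.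
by apply: rpredZ; exact: qrepr_class.
Qed.

Lemma qscaleA a b x : qscale a (qscale b x) = qscale (a * b) x.
Proof. by rewrite -[x]qreprK -!qclassZ scalerA. Qed.

Lemma qscale1 : left_id 1 qscale.
Proof. by move=> x; rewrite -[x]qreprK -qclassZ scale1r. Qed.

Lemma qscaleDr : right_distributive qscale +%R.
Proof.
move=> a x y; rewrite -[x]qreprK -[y]qreprK.
by rewrite -!(qclassD, qclassZ) scalerDr.
Qed.

Lemma qscaleDl x : {morph qscale^~ x : a b / a + b}.
Proof.
by move=> a b; rewrite -[x]qreprK -!(qclassD, qclassZ) scalerDl.
Qed.

HB.instance Definition _ :=
  GRing.Zmodule_isLmodule.Build A quotmod qscaleA qscale1 qscaleDr qscaleDl.

Lemma qclass_linear : linear qclass.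
Proof. by move=> a x y; rewrite qclassD qclassZ. Qed.

HB.instance Definition _ :=
  GRing.isLinear.Build A V quotmod *:%R qclass qclass_linear.

Lemma qclass_eq0 x : (qclass x == 0) = (x \in I).
Proof. by rewrite -(linear0 qclass) qclassE subr0. Qed.

End Submodules.

(** * Dual bases and projectivity of finitely generated ideals *)

Section DualBasis.
Variable A : comPzRingType.

(* The rows of C are the coordinate functions of a dual basis of the ideal
   generated by the entries of a: the i-th one maps a *m r to (C *m r) i 0. *)
Definition ideal_dual_basis n (a : 'rV[A]_n) (C : 'M[A]_n) : Prop :=
  a *m C = a /\ forall r : 'cV_n, a *m r = 0 -> C *m r = 0.

Lemma mx11_eq (x y : 'M[A]_1) : x 0 0 = y 0 0 -> x = y.
Proof. by move=> e; apply/matrixP=> i j; rewrite !ord1. Qed.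

Section Ideal.
Variables (n : nat) (a : 'rV[A]_n).

Lemma row_ideal0 : exists r : 'cV[A]_n, (0 : A^o) = (a *m r) 0 0.
Proof. by exists 0; rewrite mulmx0 mxE. Qed.

Lemma row_idealL (b : A) (x y : A^o) :
  (exists r : 'cV[A]_n, x = (a *m r) 0 0) ->
  (exists r : 'cV[A]_n, y = (a *m r) 0 0) ->
  exists r : 'cV[A]_n, b *: x + y = (a *m r) 0 0.
Proof.
move=> [r ->] [s ->]; exists (b *: r + s).
by rewrite mulmxDr -scalemxAr !mxE.
Qed.

Definition row_ideal : submodClosed A^o := submod_of row_ideal0 row_idealL.

Lemma row_idealP (x : A^o) :
  reflect (exists r : 'cV[A]_n, x = (a *m r) 0 0) (x \in row_ideal).
Proof. exact: submod_ofP. Qed.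

Lemma fg_row_ideal : fg_ideal row_ideal.
Proof.
exists n, (fun i => a 0 i) => x; split.
  move=> /row_idealP[r ->]; exists (fun i => r i 0).
  by rewrite mxE; apply: eq_bigr => i _; rewrite mulrC.
case=> c ->; apply/row_idealP; exists (\col_i c i).
by rewrite mxE; apply: eq_bigr => i _; rewrite !mxE mulrC.
Qed.

Definition row_elt (r : 'cV[A]_n) : ideal_module row_ideal :=
  IdealModule (introT (row_idealP _) (ex_intro _ r erefl)).

Lemma row_elt_linear : linear row_elt.
Proof.
by move=> b r s; apply: val_inj; rewrite linearP /= mulmxDr -scalemxAr !mxE.
Qed.

HB.instance Definition _ := GRing.isLinear.Build A 'cV[A]_n
  (ideal_module row_ideal) *:%R row_elt row_elt_linear.

Lemma row_elt_surj x : exists r, row_elt r = x.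
Proof.
case: x => x xI; case/row_idealP: (xI) => r xE; exists r.
by apply: val_inj; rewrite /= -xE.
Qed.

Lemma row_elt_eq0 r : row_elt r = 0 <-> a *m r = 0.
Proof.
split=> [/(congr1 val)/= e|e]; last by apply: val_inj; rewrite /= e mxE.
by apply: mx11_eq; rewrite e mxE.
Qed.

(** Projectivity splits the surjection [row_elt] from A^n onto the ideal; [C] is the matrix of
    [row_elt] followed by the section [h]. *)
Lemma row_ideal_dual_basis :
  projective (ideal_module row_ideal) -> exists C, ideal_dual_basis a C.
Proof.
move=> pI.
have [h hE] := pI _ _ row_elt idfun row_elt_surj.
exists (\matrix_(i, j) h (row_elt (delta_mx j 0)) i 0).
set C := \matrix_(i, j) _.
have CE r : C *m r = h (row_elt r).
  rewrite {2}[r]matrix_sum_delta !linear_sum.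
  apply/colP=> i; rewrite mxE summxE; apply: eq_bigr => j _.
  by rewrite big_ord1 !linearZ !mxE mulrC.
split; last by move=> r /row_elt_eq0 r0; rewrite CE r0 linear0.
apply/rowP=> j; have := hE (row_elt (delta_mx j 0)).
rewrite -CE => /(congr1 val) /=.
by rewrite mulmxA -!colE ![col _ _ _ _]mxE.
Qed.

End Ideal.

(** With [m i] over [f (a i)], the lift sends a c to the sum of the (C c)_i [m i]; a C = a makes it
    a lift of [f]. *)
Lemma dual_basis_projective (I : submodClosed A^o) n (a : 'rV[A]_n) C :
  (forall x, x \in I <-> exists r : 'cV[A]_n, x = (a *m r) 0 0) ->
  ideal_dual_basis a C -> projective (ideal_module I).
Proof.
move=> IE [aC C0] M N g f gsurj.
have aI (i : 'I_n) : (a 0 i : A^o) \in I.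
  by apply/IE; exists (delta_mx i 0); rewrite -colE mxE.
pose ai i : ideal_module I := IdealModule (aI i).
have /choice[m mE] : forall i, exists x : M, g x = f (ai i) by move=> i.
have /choice[c cE] : forall x : ideal_module I,
    exists r : 'cV[A]_n, a *m r = const_mx (val x).
  move=> x; have /IE[r xE] := valP x.
  by exists r; apply: mx11_eq; rewrite [RHS]mxE -xE.
pose h x := \sum_i (C *m c x) i 0 *: m i.
have hL : linear h.
  move=> b x y; rewrite /h scaler_sumr -big_split; apply: eq_bigr => i _ /=.
  rewrite scalerA -scalerDl; congr (_ *: _).
  (* The chosen coordinates [c] are linear only modulo the kernel of [a], which [C] kills. *)
  have /C0 : a *m (c (b *: x + y) - (b *: c x + c y)) = 0.
    rewrite mulmxBr mulmxDr -scalemxAr !cE.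
    by apply: mx11_eq; rewrite !mxE linearP /= subrr.
  rewrite mulmxBr mulmxDr -scalemxAr => /eqP; rewrite subr_eq0 => /eqP ->.
  by rewrite !mxE.
pose hl : {linear ideal_module I -> M} :=
  HB.pack h (GRing.isLinear.Build A _ M *:%R h hL).
exists hl => x; rewrite /= /h linear_sum /=.
under eq_bigr do rewrite linearZ mE -linearZ.
rewrite -linear_sum; congr (f _); apply: val_inj.
transitivity ((a *m c x) 0 0); last by rewrite cE mxE.
rewrite linear_sum /= -[in RHS]aC -mulmxA [in RHS]mxE.
by apply: eq_bigr => i _; exact: mulrC.
Qed.

Lemma semi_hereditary_dual_basis :
  semi_hereditary A <-> forall n (a : 'rV[A]_n), exists C, ideal_dual_basis a C.
Proof.
split=> [sA n a|sA I [n [g gE]]].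
  by apply: row_ideal_dual_basis; apply: sA; exact: fg_row_ideal.
have [C aC] := sA n (\row_i g i).
apply: dual_basis_projective aC => x; rewrite gE; split=> -[c ->].
  exists (\col_i c i).
  by rewrite mxE; apply: eq_bigr => i _; rewrite !mxE mulrC.
exists (fun i => c i 0).
by rewrite mxE; apply: eq_bigr => i _; rewrite !mxE mulrC.
Qed.

End DualBasis.

Section TensorSums.
Variables (A : comPzRingType) (N M : lmodType A) (I : Type) (r : seq I).

Lemma tens_suml (x : I -> N) (y : M) :
  tens (\sum_(i <- r) x i) y = \sum_(i <- r) tens (x i) y.
Proof.
apply: (big_morph (fun x => tens x y)) => [u v|]; first exact: tensDl.
by rewrite -(scale0r 0) tensZl scale0r.
Qed.

Lemma tens_sumr (x : N) (y : I -> M) :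
  tens x (\sum_(i <- r) y i) = \sum_(i <- r) tens x (y i).
Proof.
apply: (big_morph (tens x)) => [u v|]; first exact: tensDr.
by rewrite -(scale0r 0) tensZr scale0r.
Qed.

End TensorSums.

(** * From flatness to dual bases *)

Section FlatDualBasis.
Variables (A : comPzRingType) (n : nat) (a : 'rV[A]_n).

Definition torsion_over (v : 'rV[A]_n) : Prop :=
  exists2 s, GRing.lreg s & exists t, s *: v = t *: a.

Lemma torsion_over0 : torsion_over 0.
Proof.
exists 1; first exact: lreg1.
by exists 0; rewrite scale0r scaler0.
Qed.

Lemma torsion_overL b x y :
  torsion_over x -> torsion_over y -> torsion_over (b *: x + y).
Proof.
move=> [s sreg [t xE]] [s' s'reg [t' yE]].
exists (s * s'); first exact: lregM.
exists (s' * b * t + s * t').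
have -> : (s * s') *: (b *: x + y) = (s' * b) *: (s *: x) + s *: (s' *: y).
  by rewrite scalerDr !scalerA -mulrA mulrC.
by rewrite xE yE !scalerA scalerDl.
Qed.

Definition torsion_sub : submodClosed 'rV[A]_n :=
  submod_of torsion_over0 torsion_overL.

Definition torsion_quot : lmodType A := quotmod torsion_sub.

Lemma torsion_quot_torsion_free : torsion_free torsion_quot.
Proof.
move=> s sreg x y /=; rewrite -[x]qreprK -[y]qreprK -!linearZ => /eqP.
rewrite qclassE -scalerBr => /submod_ofP[s' s'reg [t e]].
apply/eqP; rewrite qclassE; apply/submod_ofP.
by exists (s' * s); [exact: lregM | exists t; rewrite -scalerA].
Qed.

(** Identifying r (x) v with [r *m v], the matrices modulo this submodule are (A^n / ker a) (x) (A^n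
    / torsion_over), the ideal tensored with [torsion_quot]. *)
Definition split_mx (P : 'M[A]_n) : Prop :=
  exists D, a *m D = 0 /\ forall i, torsion_over (row i (P - D)).

Lemma split_mx0 : split_mx 0.
Proof.
exists 0; split=> [|i]; first by rewrite mulmx0.
by rewrite subrr row0; exact: torsion_over0.
Qed.

Lemma split_mxL b P Q : split_mx P -> split_mx Q -> split_mx (b *: P + Q).
Proof.
move=> [D [aD PD]] [E [aE QE]]; exists (b *: D + E); split=> [|i].
  by rewrite mulmxDr -scalemxAr aD aE scaler0 addr0.
by rewrite opprD addrACA -scalerBr linearP; exact: torsion_overL (PD i) (QE i).
Qed.

Definition split_sub : submodClosed 'M[A]_n := submod_of split_mx0 split_mxL.

Lemma split_mx_mull (r : 'cV_n) v : torsion_over v -> split_mx (r *m v).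
Proof.
move=> Tv; exists 0; split=> [|i]; first by rewrite mulmx0.
rewrite subr0 row_mul; have -> : row i r = (r i 0)%:M.
  by apply: mx11_eq; rewrite !mxE eqxx.
rewrite mul_scalar_mx -[_ *: _]addr0.
by apply: torsion_overL => //; exact: torsion_over0.
Qed.

Lemma split_mx_mulr (r : 'cV_n) (v : 'rV_n) : a *m r = 0 -> split_mx (r *m v).
Proof.
move=> ar; exists (r *m v); split=> [|i]; first by rewrite mulmxA ar mul0mx.
by rewrite subrr row0; exact: torsion_over0.
Qed.

(** Take C = 1 - D: each row of C has a regular multiple in A a, so it kills whatever [a] kills. *)
Lemma split_mx1_dual_basis : split_mx 1%:M -> exists C, ideal_dual_basis a C.
Proof.
move=> [D [aD DT]]; exists (1%:M - D); split.
  by rewrite mulmxBr aD subr0 mulmx1.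
move=> r ar; apply/row_matrixP=> i; rewrite row_mul row0.
have [s sreg [t e]] := DT i.
have : s *: (row i (1%:M - D) *m r) = 0.
  by rewrite scalemxAl e -scalemxAl ar scaler0.
move=> /matrixP/(_ 0 0); rewrite mxE [RHS]mxE => e0.
by apply: mx11_eq; apply: sreg; rewrite e0 mxE mulr0.
Qed.

(* The equation a *m 1 = 0 in the torsion-free module A^n / torsion_over
   becomes, by flatness, an equality in the tensor product with the ideal
   generated by a; its image under this pairing is that 1 is in split_mx. *)
Lemma torsion_quot_flat_dual_basis :
  flat torsion_quot -> exists C, ideal_dual_basis a C.
Proof.
move=> fM; apply: split_mx1_dual_basis.
have /choice[c cE] :
    forall x : ideal_module (row_ideal a), exists r, row_elt a r = x.
  exact: row_elt_surj.
pose b x (y : torsion_quot) : quotmod split_sub :=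
  qclass split_sub (c x *m qrepr y).
(* The pairing does not depend on the representatives picked by [c] and [qrepr]. *)
have splitE r v x y : row_elt a r = x -> qclass torsion_sub v = y ->
    b x y = qclass split_sub (r *m v).
  move=> rE vE; apply/eqP; rewrite qclassE; apply/submod_ofP.
  rewrite -[_ - _](subrKA (r *m qrepr y)) -mulmxBl -mulmxBr.
  rewrite -[_ *m _]scale1r; apply: split_mxL.
    apply/split_mx_mulr/row_elt_eq0.
    by rewrite linearB /= cE rE subrr.
  apply/split_mx_mull/(@submod_ofP _ _ _ torsion_over0 torsion_overL).
  by rewrite -qclassE qreprK vE.
have bb : bilinear_map b.
  split=> [y k x x'|x k y y'].
    rewrite (splitE (k *: c x + c x') (qrepr y)) ?qreprK //.
      by rewrite mulmxDl -scalemxAl linearP.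
    by rewrite linearP /= !cE.
  rewrite (splitE (c x) (k *: qrepr y + qrepr y')) //.
    by rewrite mulmxDr -scalemxAr linearP.
  by rewrite linearP /= !qreprK.
pose e i : 'rV[A]_n := delta_mx 0 i.
pose u : tensor (ideal_module (row_ideal a)) torsion_quot :=
  \sum_i tens (row_elt a (delta_mx i 0)) (qclass torsion_sub (e i)).
have u0 : u = 0.
  pose v : {linear ideal_module (row_ideal a) -> A^o} := val.
  apply: (fM _ _ v val_inj); rewrite linear0 linear_sum.
  (* Inside A the coefficients a_i cross the tensor sign, leaving 1 (x) [a], and [a] = 0. *)
  transitivity (\sum_i tens (1 : A^o) (a 0 i *: qclass torsion_sub (e i))).
    apply: eq_bigr => i _; rewrite [LHS]tensor_mapE tensZr -tensZl /= -colE mxE.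
    by rewrite [_ *: _]mulr1.
  rewrite -tens_sumr; under eq_bigr do rewrite -linearZ.
  rewrite -linear_sum -row_sum_delta /=.
  suff /eqP-> : qclass torsion_sub a == 0.
    by rewrite -(scale0r 0) tensZr scale0r.
  rewrite qclass_eq0; apply/submod_ofP.
  by exists 1; [exact: lreg1 | exists 1].
apply/(@submod_ofP _ _ _ split_mx0 split_mxL); rewrite -qclass_eq0.
pose h : {linear _ -> _} := HB.pack (tensor_lift b)
  (GRing.isLinear.Build A _ _ *:%R _ (tensor_lift_linear bb)).
have := congr1 h u0; rewrite linear0 linear_sum /= => hu.
apply/eqP; rewrite -hu.
rewrite (mx1_sum_delta A n) linear_sum; apply: eq_bigr => i _.
rewrite [RHS]tensor_liftE // (splitE (delta_mx i 0) (e i)) //.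
by rewrite mul_delta_mx.
Qed.

End FlatDualBasis.

(** * Linear maps from free modules into M *)

Section LinearCombinations.
Variables (A : comPzRingType) (M : lmodType A).

Definition lincomb p (z : 'I_p -> M) (c : 'rV[A]_p) : M :=
  \sum_i c 0 i *: z i.

Lemma lincomb_linear p (z : 'I_p -> M) : linear (lincomb z).
Proof.
move=> b x y; rewrite /lincomb scaler_sumr -big_split; apply: eq_bigr => i _ /=.
by rewrite !mxE scalerDl scalerA.
Qed.

HB.instance Definition _ p (z : 'I_p -> M) :=
  GRing.isLinear.Build A 'rV[A]_p M *:%R (lincomb z) (lincomb_linear z).

Lemma lincomb_mulmx p q (z : 'I_q -> M) (P : 'M_(p, q)) c :
  lincomb z (c *m P) = lincomb (fun i => lincomb z (row i P)) c.
Proof.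
rewrite {1}(row_sum_delta c) mulmx_suml linear_sum.
by apply: eq_bigr => i _; rewrite -scalemxAl linearZ -rowE.
Qed.

(** The family is [s] itself, and [l y] is the unit vector at the first position of [y]. *)
Lemma lincomb_lift (s : seq M) :
  exists p (z : 'I_p -> M) (l : M -> 'rV_p),
    forall y, y \in s -> lincomb z (l y) = y.
Proof.
exists (size s), (fun i => s`_i), (fun y => \row_i (i == index y s :> nat)%:R).
move=> y ys; have iy : (index y s < size s)%N by rewrite index_mem.
rewrite /lincomb (bigD1 (Ordinal iy)) //= mxE eqxx scale1r nth_index //.
rewrite big1 ?addr0 //.
by move=> i; rewrite mxE -val_eqE /= => /negPf->; rewrite scale0r.
Qed.

(** Both maps factor through A^(p+q) by concatenating the families. *)
Lemma lincomb_common p q (z : 'I_p -> M) (w : 'I_q -> M) :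
  exists r (v : 'I_r -> M) (P : 'M_(p, r)) (Q : 'M_(q, r)),
    (forall c, lincomb v (c *m P) = lincomb z c) /\
    (forall c, lincomb v (c *m Q) = lincomb w c).
Proof.
pose v i := match split i with inl j => z j | inr j => w j end.
exists (p + q)%N, v, (row_mx 1%:M 0), (row_mx 0 1%:M).
have vE c d : lincomb v (row_mx c d) = lincomb z c + lincomb w d.
  rewrite /lincomb big_split_ord; congr (_ + _); apply: eq_bigr => i _.
    by rewrite row_mxEl /v (unsplitK (inl i)).
  by rewrite row_mxEr /v (unsplitK (inr i)).
split=> c; rewrite mul_mx_row mulmx1 mulmx0 vE linear0 ?addr0 //.
by rewrite add0r.
Qed.

End LinearCombinations.

(** * Relations in torsion-free modules and equality of tensors *)

Section Equalizing.
Variable A : comPzRingType.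
Hypothesis dbA : forall n (a : 'rV[A]_n), exists C, ideal_dual_basis a C.

(** Take e = 1 - c with (c) a dual basis of (a): e kills a and fixes its annihilator. If (a + e) u =
    0, multiplying by e gives e u = 0, so a u = 0 and u = e u = 0. *)
Lemma annihilator_idempotent (a : A) :
  exists e, [/\ e * a = 0, e * e = e & GRing.lreg (a + e)].
Proof.
have [C [aC C0]] := dbA (a%:M : 'M_1).
pose c := C 0 0.
have ac : a * c = a.
  by move/matrixP/(_ 0 0): aC; rewrite mul_scalar_mx !mxE.
have c0 x : a * x = 0 -> c * x = 0.
  move=> ax; have /C0/matrixP/(_ 0 0) : a%:M *m (x%:M : 'M_1) = 0.
    by apply: mx11_eq; rewrite mul_scalar_mx !mxE.
  by rewrite mul_mx_scalar !mxE mulrC.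
have ea : (1 - c) * a = 0 by rewrite mulrBl mul1r mulrC ac subrr.
have ee x : a * x = 0 -> (1 - c) * x = x.
  by move=> /c0 cx; rewrite mulrBl mul1r cx subr0.
have eK : (1 - c) * (1 - c) = 1 - c by apply: ee; rewrite mulrC.
exists (1 - c); split=> // x y /= /eqP; rewrite -subr_eq0 -mulrBr => /eqP exy.
apply/eqP; rewrite -subr_eq0; apply/eqP; move: (x - y) exy => u aeu.
have eu : (1 - c) * u = 0.
  have := congr1 ( *%R (1 - c)) aeu.
  by rewrite mulr0 mulrA mulrDr ea add0r eK.
by rewrite -(ee u) //; move: aeu; rewrite mulrDl eu addr0.
Qed.

Variable M : lmodType A.
Hypothesis tfM : torsion_free M.

(* w := lincomb z (row i C) is killed by every a_k, hence fixed by every e_k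
   with a_k + e_k regular, while the product of the e_k kills row i C. *)
Lemma dual_basis_relation p (z : 'I_p -> M) (a : 'rV_p) C :
  ideal_dual_basis a C -> lincomb z a = 0 ->
  forall i, lincomb z (row i C) = 0.
Proof.
move=> [_ C0] za i; set w := lincomb _ _.
(* [C] kills the trivial syzygies a_k e_j - a_j e_k. *)
have Ca j k : a 0 k * C i j = a 0 j * C i k.
  have /C0/colP/(_ i) :
      a *m (a 0 k *: delta_mx j 0 - a 0 j *: delta_mx k 0 : 'cV_p) = 0.
    apply: mx11_eq; rewrite mulmxBr -!scalemxAr -!colE !mxE.
    by rewrite mulrC subrr.
  rewrite mulmxBr -!scalemxAr -!colE !mxE => /eqP.
  by rewrite subr_eq0 => /eqP.
have /choice[e eP] k := annihilator_idempotent (a 0 k).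
have ew k : e k *: w = w.
  have [ea eK reg] := eP k.
  have aw : a 0 k *: w = 0.
    transitivity (C i k *: lincomb z a); last by rewrite za scaler0.
    rewrite -!linearZ; congr (lincomb z _).
    by apply/rowP=> j; rewrite !mxE Ca mulrC.
  apply: (tfM reg); rewrite /= scalerA mulrDl mulrC ea add0r eK.
  by rewrite scalerDl aw add0r.
have eC k : e k * C i k = 0.
  have [ea _ _] := eP k.
  have /C0/colP/(_ i) : a *m (e k *: delta_mx k 0 : 'cV_p) = 0.
    by apply: mx11_eq; rewrite -scalemxAr -colE !mxE ea.
  by rewrite -scalemxAr -colE !mxE.
have <- : (\prod_k e k) *: w = w.
  elim/big_ind: _ => [|x y xw yw|k _]; [exact: scale1r | | exact: ew].
  by rewrite -scalerA yw xw.
rewrite -linearZ; apply: big1 => k _.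
by rewrite !mxE (bigD1 k) //= mulrC mulrA [C i k * _]mulrC eC mul0r scale0r.
Qed.

(** Relations are killed one at a time: for a dual basis C of d P, the right factor 1 - C kills d P,
    keeps earlier relations zero and preserves values in M. *)
Lemma relations_trivial p (z : 'I_p -> M) (ds : seq 'rV_p) :
  (forall d, d \in ds -> lincomb z d = 0) ->
  exists P : 'M_p, (forall c, lincomb z (c *m P) = lincomb z c) /\
    forall d, d \in ds -> d *m P = 0.
Proof.
elim: ds => [|d ds IH] zds.
  by exists 1%:M; split=> // c; rewrite mulmx1.
have [|P [zP dsP]] := IH; first by move=> c cds; rewrite zds // inE cds orbT.
have [C dbC] := dbA (d *m P).
have zC c : lincomb z (c *m C) = 0.
  rewrite lincomb_mulmx; apply: big1 => i _ /=.
  rewrite (dual_basis_relation dbC) ?scaler0 // zP.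
  by rewrite zds // mem_head.
exists (P *m (1%:M - C)); split=> [c|c].
  by rewrite mulmxA mulmxBr mulmx1 linearB /= zC subr0 zP.
rewrite inE => /predU1P[->|/dsP cP]; last by rewrite mulmxA cP mul0mx.
by rewrite mulmxA mulmxBr dbC.1 mulmx1 subrr.
Qed.

Variable N : lmodType A.

Definition eval_item p (z : 'I_p -> M) (q : N * 'rV[A]_p) : N * M :=
  (q.1, lincomb z q.2).
Definition push_item p r (P : 'M[A]_(p, r)) (q : N * 'rV[A]_p) : N * 'rV[A]_r :=
  (q.1, q.2 *m P).
(** The j-th coordinate under the isomorphism N (x) A^p = N^p. *)
Definition coord_sum p (s : seq (N * 'rV[A]_p)) (j : 'I_p) : N :=
  \sum_(q <- s) q.2 0 j *: q.1.

Lemma coord_sum_push p r (P : 'M[A]_(p, r)) s j :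
  coord_sum (map (push_item P) s) j = \sum_i P i j *: coord_sum s i.
Proof.
rewrite /coord_sum big_map /=.
under [RHS]eq_bigr do rewrite scaler_sumr.
rewrite exchange_big; apply: eq_bigr => q _ /=.
rewrite mxE scaler_suml; apply: eq_bigr => i _.
by rewrite scalerA mulrC.
Qed.

Lemma eval_push p r z v (P : 'M[A]_(p, r)) s :
  (forall c, lincomb v (c *m P) = lincomb z c) ->
  map (eval_item v) (map (push_item P) s) = map (eval_item z) s.
Proof.
move=> vP; rewrite -map_comp; apply: eq_map => q.
by rewrite /= /eval_item /= vP.
Qed.

Lemma eval_equalize p q (z : 'I_p -> M) (w : 'I_q -> M) s t :
  map (eval_item z) s = map (eval_item w) t ->
  exists r (v : 'I_r -> M) (P : 'M_(p, r)) (Q : 'M_(q, r)),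
    [/\ forall c, lincomb v (c *m P) = lincomb z c,
        forall c, lincomb v (c *m Q) = lincomb w c &
        map (push_item P) s = map (push_item Q) t].
Proof.
move=> st; have [r [v [P [Q [vP vQ]]]]] := lincomb_common z w.
(* Differences of two lifts of the same element of M are relations, so a further matrix kills them
   all. *)
pose ds := [seq x.1.2 *m P - x.2.2 *m Q | x <- zip s t].
have ds0 d : d \in ds -> lincomb v d = 0.
  rewrite /ds; elim: s t st {ds} => [|x s IH] [|y t] //= [_ xy st].
  rewrite inE => /predU1P[->|]; last exact: IH.
  by rewrite linearB /= vP vQ xy subrr.
have [R [vR dR]] := relations_trivial ds0.
exists r, v, (P *m R), (Q *m R).
split=> [c|c|]; [by rewrite mulmxA vR vP | by rewrite mulmxA vR vQ |].
rewrite /ds in dR.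
elim: s t st dR {ds ds0} => [|x s IH] [|y t] //= [xy1 _ st] dR.
congr (_ :: _); last first.
  by apply: IH => // d dst; apply: dR; rewrite inE dst orbT.
rewrite /push_item xy1; congr (_, _); rewrite !mulmxA; apply/eqP.
by rewrite -subr_eq0 -mulmxBl dR ?mem_head.
Qed.

(* s and t are the images of sums of pure tensors in N (x) A^p, for one linear
   map A^p -> M, which are already equal in N (x) A^p = N^p. *)
Definition free_eq (s t : seq (N * M)) : Prop :=
  exists p (z : 'I_p -> M) s' t',
    [/\ s = map (eval_item z) s', t = map (eval_item z) t' &
        forall j, coord_sum s' j = coord_sum t' j].

(** The two lifts of the middle sum [t] become equal in a common A^r, where the coordinate
    equalities can be chained. *)
Lemma free_eq_trans t s u : free_eq s t -> free_eq t u -> free_eq s u.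
Proof.
move=> [p [z [s' [t' [-> -> st]]]]] [q [w [t'' [u' [tt -> tu]]]]].
have [r [v [P [Q [vP vQ PQ]]]]] := eval_equalize tt.
exists r, v, (map (push_item P) s'), (map (push_item Q) u').
split=> [||j]; [by rewrite (eval_push _ vP) | by rewrite (eval_push _ vQ) |].
transitivity (coord_sum (map (push_item P) t') j).
  by rewrite !coord_sum_push; apply: eq_bigr => i _; rewrite st.
by rewrite PQ !coord_sum_push; apply: eq_bigr => i _; rewrite tu.
Qed.

Lemma free_eq_cat s s' t t' :
  free_eq s t -> free_eq s' t' -> free_eq (s ++ s') (t ++ t').
Proof.
move=> [p [z [x [y [-> -> xy]]]]] [q [w [x' [y' [-> -> xy']]]]].
have [r [v [P [Q [vP vQ]]]]] := lincomb_common z w.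
exists r, v, (map (push_item P) x ++ map (push_item Q) x').
exists (map (push_item P) y ++ map (push_item Q) y').
split=> [||j]; try by rewrite map_cat (eval_push _ vP) (eval_push _ vQ).
rewrite /coord_sum !big_cat -!/(coord_sum _ _) /= !coord_sum_push.
by congr (_ + _); apply: eq_bigr => i _; rewrite ?xy ?xy'.
Qed.

Lemma free_eq_perm s t : perm_eq s t -> free_eq s t.
Proof.
move=> st; have [p [z [l lE]]] := lincomb_lift (map snd s).
pose g (q : N * M) := (q.1, l q.2).
have gK q : q \in s -> eval_item z (g q) = q.
  by case: q => x y /(map_f snd)/lE; rewrite /eval_item /= => ->.
exists p, z, (map g s), (map g t); split=> [||j].
- by rewrite -map_comp -[LHS]map_id; apply/eq_in_map => q /gK.
- rewrite -map_comp -[LHS]map_id; apply/eq_in_map => q.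
  by rewrite -(perm_mem st) => /gK.
- by apply: perm_big; exact: perm_map.
Qed.

(** Each bilinearity relation already holds over the free module on the elements of M it involves;
    torsion-freeness enters through transitivity. *)
Lemma tensor_rel_free_eq s t : tensor_rel s t -> free_eq s t.
Proof.
elim=> {s t} [s|s t _|t s u _ + _|s t|s s' t t' _ + _|y|x x' y|x y y'|a x y].
- exact: free_eq_perm.
- by move=> [p [z [s' [t' [-> -> st]]]]]; exists p, z, t', s'; split.
- exact: free_eq_trans.
- exact: free_eq_perm.
- exact: free_eq_cat.
- have [p [z [l lE]]] := lincomb_lift [:: y].
  exists p, z, [:: (0, l y)], [::]; rewrite /= /eval_item /= lE ?mem_head //.
  by split=> // j; rewrite /coord_sum big_seq1 big_nil scaler0.
- have [p [z [l lE]]] := lincomb_lift [:: y].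
  exists p, z, [:: (x + x', l y)], [:: (x, l y); (x', l y)].
  rewrite /= /eval_item /= lE ?mem_head //.
  by split=> // j; rewrite /coord_sum big_seq1 big_cons big_seq1 scalerDr.
- have [p [z [l lE]]] := lincomb_lift [:: y; y'].
  exists p, z, [:: (x, l y + l y')], [:: (x, l y); (x, l y')].
  rewrite /= /eval_item /= linearD /= !lE ?inE ?eqxx ?orbT //.
  by split=> // j; rewrite /coord_sum big_seq1 big_cons big_seq1 mxE scalerDl.
- have [p [z [l lE]]] := lincomb_lift [:: y].
  exists p, z, [:: (a *: x, l y)], [:: (x, a *: l y)].
  rewrite /= /eval_item /= linearZ /= lE ?mem_head //.
  by split=> // j; rewrite /coord_sum !big_seq1 mxE scalerA mulrC.
Qed.

Lemma tclass_eval p (z : 'I_p -> M) s :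
  tclass (map (eval_item z) s) = \sum_j tens (coord_sum s j) (z j).
Proof.
rewrite tclassE big_map /=.
under [RHS]eq_bigr do rewrite tens_suml.
rewrite exchange_big; apply: eq_bigr => q _ /=.
by rewrite tens_sumr; apply: eq_bigr => j _; rewrite tensZl tensZr.
Qed.

End Equalizing.

Lemma torsion_free_flat (A : comPzRingType) (M : lmodType A) :
  (forall n (a : 'rV[A]_n), exists C, ideal_dual_basis a C) ->
  torsion_free M -> flat M.
Proof.
move=> dbA tfM N N' f f_inj t u.
rewrite -[t]treprK -[u]treprK; move: (trepr t) (trepr u) => {}t {}u.
pose g R (q : N * R) : N' * R := (f q.1, q.2).
have mapE s : tensor_map M f (tclass s) = tclass (map (@g M) s).
  rewrite !tclassE linear_sum big_map; apply: eq_bigr => q _.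
  exact: tensor_mapE.
rewrite !mapE => /tclassP/(tensor_rel_free_eq dbA tfM).
move=> [p [z [t' [u' [tE uE tu]]]]].
(* [g] changes only first components and [eval_item] only second ones, so lifts of the image are
   images of lifts. *)
have pull s s' : map (@g M) s = map (eval_item z) s' ->
    exists2 r, s = map (eval_item z) r & s' = map (@g _) r.
  elim: s s' => [|[x y] s IH] [|[x' c] s'] //=; first by exists [::].
  by move=> [<- -> /IH[r -> ->]]; exists ((x, c) :: r).
have [t1 -> t1E] := pull _ _ tE; have [u1 -> u1E] := pull _ _ uE.
rewrite !tclass_eval; apply: eq_bigr => j _; congr (tens _ _).
have gE r : coord_sum (map (@g _) r) j = f (coord_sum r j).
  rewrite /coord_sum big_map linear_sum.
  by apply: eq_bigr => q _; rewrite linearZ.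
(* On N^p the induced map is [f] in each coordinate, hence injective. *)
by apply: f_inj; rewrite -!gE -t1E -u1E.
Qed.

Theorem theorem4p10 (A : comPzRingType) :
  semi_hereditary A <->
  (forall M : lmodType A, torsion_free M -> flat M).
Proof.
split=> [/semi_hereditary_dual_basis dbA M|flatA].
  exact: torsion_free_flat.
apply/semi_hereditary_dual_basis => n a.
apply: torsion_quot_flat_dual_basis; apply: flatA.
exact: torsion_quot_torsion_free.
Qed.
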